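(* Let $d>1$, $n\ge1$. Consider the model in which ${\bf y}_1,\dots,{\bf y}_n$ are i.i.d. $\mathcal{N}(\boldsymbol{\theta},\Lambda)$ with $\Lambda$ a known $d\times d$ (nonsingular) covariance matrix and $\boldsymbol{\theta}\in\mathbb{R}^d$ unknown with prior $\mathcal{N}(\boldsymbol{\mu}^{\pi},\Sigma^{\pi})$ ($\Sigma^{\pi}$ nonsingular). Let $\overline{\bf y}_n=\frac1n\sum_{i=1}^n{\bf y}_i$, $\Sigma^{L}=\Lambda/n$, $\Sigma^{p}=\left[(\Sigma^{\pi})^{-1}+(\Sigma^{L})^{-1}\right]^{-1}$, and let $\eta=\boldsymbol{\lambda}^{\top}\boldsymbol{\theta}$ for a given $\boldsymbol{\lambda}\in\mathbb{R}^d$. Then the discrepant posterior phenomenon (DPP) for $\eta$ occurs with probability $$P_{{\bf y}_n\mid\boldsymbol{\theta}}\left(n\,\boldsymbol{\lambda}^{\top}\Sigma^{p}\Lambda^{-1}(\overline{\bf y}_n-\boldsymbol{\mu}^{\pi})(\overline{\bf y}_n-\boldsymbol{\mu}^{\pi})^{\top}(\Sigma^{\pi})^{-1}\Sigma^{p}\boldsymbol{\lambda}<0\right),$$ where the probability $P_{{\bf y}_n\mid\boldsymbol{\theta}}$ is taken with respect to the true data generating model.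
   Context: In this model the likelihood is $L(\boldsymbol{\theta}\mid{\bf y})\propto\phi(\boldsymbol{\theta};\boldsymbol{\mu}^{L},\Sigma^{L})$ with $\boldsymbol{\mu}^{L}=\overline{\bf y}_n$ and $\Sigma^{L}=\Lambda/n$, where $\phi(\cdot;\boldsymbol{\mu},\Sigma)$ is the Gaussian density with mean $\boldsymbol{\mu}$ and covariance $\Sigma$ (covariance matrices of the prior and of the model are symmetric positive definite). The posterior is computed from the prior and this likelihood; $\boldsymbol{\mu}^{p}$ denotes the posterior mean of $\boldsymbol{\theta}$. Write $\eta^{p}=\boldsymbol{\lambda}^{\top}\boldsymbol{\mu}^{p}$, $\eta^{\pi}=\boldsymbol{\lambda}^{\top}\boldsymbol{\mu}^{\pi}$, $\eta^{L}=\boldsymbol{\lambda}^{\top}\boldsymbol{\mu}^{L}$. Definition: the discrepant posterior phenomenon (DPP) occurs if $(\eta^{p}-\eta^{\pi})(\eta^{p}-\eta^{L})>0$. The ''true data generating model'' is the actual probability distribution of the data $({\bf y}_1,\dots,{\bf y}_n)$; it may differ from the model assumed by the analyst. *)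

(* Defs.v *)
From HB Require Import structures.
From mathcomp Require Import all_boot all_order all_algebra.
From mathcomp Require Import all_classical all_reals all_analysis.

Set Implicit Arguments.
Unset Strict Implicit.
Unset Printing Implicit Defensive.

Import Order.TTheory GRing.Theory Num.Theory.
Import numFieldNormedType.Exports.

Local Open Scope classical_set_scope.
Local Open Scope ring_scope.

(* MathComp-Analysis has no Lebesgue measure on R^d.  The type of d-tuples of
   reals carries the product sigma-algebra (library instance); its Lebesgue
   measure is built by iterating the binary product measure. *)
Section lebesgue_tuple.
Variable R : realType.
Local Notation mR := (measurableTypeR R).

Definition cons_pair d (p : mR * d.-tuple mR) : d.+1.-tuple mR :=
  [tuple of p.1 :: p.2].

Lemma measurable_cons_pair d : measurable_fun setT (@cons_pair d).
Proof. exact: (measurable_cons measurable_fst measurable_snd). Qed.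

Section cons_measure.
Variables (d : nat) (m : {sigma_finite_measure set (d.-tuple mR) -> \bar R}).

Definition cons_measure : set (d.+1.-tuple mR) -> \bar R :=
  pushforward (@lebesgue_measure R \x m)%E (@cons_pair d).

Let cons_measure0 : cons_measure set0 = 0%E.
Proof. by rewrite /cons_measure /pushforward preimage_set0 measure0. Qed.

Let cons_measure_ge0 A : (0 <= cons_measure A)%E.
Proof. by rewrite /cons_measure /pushforward measure_ge0. Qed.

Let cons_measure_sigma_additive : semi_sigma_additive cons_measure.
Proof.
move=> F mF tF mUF; rewrite /cons_measure /pushforward preimage_bigcup.
have mpre A : measurable A -> measurable (@cons_pair d @^-1` A).
  by move=> mA; rewrite -[X in measurable X]setTI; exact: measurable_cons_pair.
apply: measure_semi_sigma_additive.
- by move=> n; exact: mpre.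
- by move=> i j _ _ [p [? ?]]; apply: tF => //; exists (cons_pair p).
- by rewrite -preimage_bigcup; exact: mpre.
Qed.

HB.instance Definition _ := isMeasure.Build _ _ _ cons_measure
  cons_measure0 cons_measure_ge0 cons_measure_sigma_additive.

Let cons_measure_sigma_finite : sigma_finite setT cons_measure.
Proof.
have /sigma_finiteP[F [TF ndF Foo]] := sigma_finiteT (@lebesgue_measure R).
have /sigma_finiteP[G [TG ndG Goo]] := sigma_finiteT m.
pose u (t : d.+1.-tuple mR) : mR * d.-tuple mR := (thead t, behead_tuple t).
have uK : cancel (@cons_pair d) u.
  by move=> [x t]; congr pair; apply/val_inj.
have mu_ : measurable_fun setT u.
  by apply/measurable_fun_pairP; split;
    [exact: measurable_tnth|exact: measurable_behead].
exists (fun k => u @^-1` (F k `*` G k)).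
  rewrite -preimage_bigcup (_ : \bigcup_k _ = setT) ?preimage_setT//.
  apply/seteqP; split=> // -[x t] _.
  have [i _ Fx] : (\bigcup_k F k) x by rewrite -TF.
  have [j _ Gt] : (\bigcup_k G k) t by rewrite -TG.
  exists (maxn i j) => //; split => /=.
    by move: x Fx; exact/subsetPset/ndF/leq_maxl.
  by move: t Gt; exact/subsetPset/ndG/leq_maxr.
move=> k; have [mF Fk] := Foo k; have [mG Gk] := Goo k; split.
  by rewrite -[X in measurable X]setTI; apply: mu_ => //; exact: measurableX.
rewrite /cons_measure /pushforward -comp_preimage.
rewrite (_ : u \o _ = id); last by apply/funext => p /=; rewrite uK.
rewrite preimage_id product_measure1E//.
by rewrite lte_mul_pinfty// ge0_fin_numE.
Qed.

HB.instance Definition _ := Measure_isSigmaFinite.Build _ _ _ cons_measure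
  cons_measure_sigma_finite.

End cons_measure.

Fixpoint lebesgue_tuple (d : nat) :
    {sigma_finite_measure set (d.-tuple mR) -> \bar R} :=
  match d with
  | 0 => @dirac _ (0.-tuple mR) [tuple] R
  | d'.+1 => cons_measure (lebesgue_tuple d')
  end.

End lebesgue_tuple.

Section gaussian_model.
Variables (R : realType) (d : nat).
Local Notation mR := (measurableTypeR R).
Implicit Types (mu x theta lambda : 'cV[R]_d) (S : 'M[R]_d).

Definition colt (t : d.-tuple mR) : 'cV[R]_d := \col_i (tnth t i : R).

Definition sym_posdef S : Prop :=
  S^T = S /\ forall x, x != 0 -> 0 < (x^T *m S *m x) 0 0.

Definition gauss_pdf mu S x : R :=
  (Num.sqrt ((2 * pi) ^+ d * \det S))^-1 *
  expR (- (((x - mu)^T *m invmx S *m (x - mu)) 0 0 / 2)).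

Definition pdf_mean (f : 'cV[R]_d -> R) : 'cV[R]_d :=
  \col_i \int[lebesgue_tuple R d]_t (colt t i 0 * f (colt t)).

(* Bayes' rule: the normalized product of the prior and the likelihood. *)
Definition posterior_pdf (prior lik : 'cV[R]_d -> R) theta : R :=
  prior theta * lik theta /
  \int[lebesgue_tuple R d]_t (prior (colt t) * lik (colt t)).

Section sample.
Variable n : nat.
Implicit Type y : 'I_n -> 'cV[R]_d.

(* Likelihood of theta for y_1, ..., y_n i.i.d. N(theta, Lambda); as a
   function of theta it is proportional to
   gauss_pdf (sample_mean y) (n%:R^-1 *: Lambda). *)
Definition likelihood (Lambda : 'M[R]_d) y theta : R :=
  \prod_(i < n) gauss_pdf theta Lambda (y i).

Definition sample_mean y : 'cV[R]_d := n%:R^-1 *: \sum_(i < n) y i.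

Definition posterior_mean (mupi : 'cV[R]_d) (Sigmapi Lambda : 'M[R]_d) y :
    'cV[R]_d :=
  pdf_mean (posterior_pdf (gauss_pdf mupi Sigmapi) (likelihood Lambda y)).

End sample.

Definition linear_eta lambda theta : R := (lambda^T *m theta) 0 0.

(* Discrepant posterior phenomenon for the prior, likelihood and posterior
   values etapi, etaL, etap of eta. *)
Definition DPP (etapi etaL etap : R) : Prop :=
  0 < (etap - etapi) * (etap - etaL).

End gaussian_model.

(* Main.v *)
Require Import Defs.
From HB Require Import structures.
From mathcomp Require Import all_boot all_order all_algebra.
From mathcomp Require Import all_classical all_reals all_analysis.
From mathcomp Require Import measurable_realfun.
From mathcomp Require Import ring lra.

Set Implicit Arguments.
Unset Strict Implicit.
Unset Printing Implicit Defensive.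

Import Order.TTheory GRing.Theory Num.Theory.
Import numFieldNormedType.Exports.

Local Open Scope classical_set_scope.
Local Open Scope ring_scope.

(* Completing the square, prior times likelihood is a constant times
   exp (- (theta - m)^T A (theta - m) / 2) with A = Sigmapi^-1 + n Lambda^-1 and
   A m = Sigmapi^-1 mupi + n Lambda^-1 ybar.  This kernel is symmetric about m
   and Lebesgue measure is invariant under theta |-> 2 m - theta, so the
   posterior mean is m; no normalizing constant has to be computed, only its
   positivity and the integrability of the first moments, which follow by
   comparison with a product of one-dimensional Gaussians.  Then
   m - mupi = n A^-1 Lambda^-1 (ybar - mupi) and
   m - ybar = - A^-1 Sigmapi^-1 (ybar - mupi), so that the product defining the
   discrepant posterior phenomenon is the opposite of the quantity in the
   theorem. *)

(** * Bilinear forms and symmetric positive definite matrices *)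

Section quadratic_forms.
Variables (R : realType) (d : nat).
Implicit Types (S Q A : 'M[R]_d) (x y u : 'cV[R]_d).

Definition bilin S x y : R := (x^T *m S *m y) 0 0.

Lemma bilinDl S x y u : bilin S (x + y) u = bilin S x u + bilin S y u.
Proof. by rewrite /bilin linearD /= !mulmxDl mxE. Qed.

Lemma bilinZl S a x u : bilin S (a *: x) u = a * bilin S x u.
Proof. by rewrite /bilin linearZ /= -!scalemxAl mxE. Qed.

Lemma bilinDr S x y u : bilin S u (x + y) = bilin S u x + bilin S u y.
Proof. by rewrite /bilin mulmxDr mxE. Qed.

Lemma bilinZr S a x u : bilin S u (a *: x) = a * bilin S u x.
Proof. by rewrite /bilin -scalemxAr mxE. Qed.

Lemma bilinNl S x u : bilin S (- x) u = - bilin S x u.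
Proof. by rewrite -scaleN1r bilinZl mulN1r. Qed.

Lemma bilinNr S x u : bilin S u (- x) = - bilin S u x.
Proof. by rewrite -scaleN1r bilinZr mulN1r. Qed.

Lemma bilinDm S Q x y : bilin (S + Q) x y = bilin S x y + bilin Q x y.
Proof. by rewrite /bilin mulmxDr mulmxDl mxE. Qed.

Lemma bilinZm a S x y : bilin (a *: S) x y = a * bilin S x y.
Proof. by rewrite /bilin -scalemxAr -scalemxAl mxE. Qed.

Lemma bilin_sumr (I : finType) S u (y : I -> 'cV[R]_d) :
  bilin S u (\sum_i y i) = \sum_i bilin S u (y i).
Proof. by rewrite /bilin mulmx_sumr summxE. Qed.

Lemma bilinC S x y : S^T = S -> bilin S x y = bilin S y x.
Proof.
move=> SS; rewrite /bilin.
transitivity ((x^T *m S *m y)^T 0 0); first by rewrite [RHS]mxE.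
by rewrite !trmx_mul trmxK SS mulmxA.
Qed.

Lemma bilin_sqrB S x u : S^T = S ->
  bilin S (x - u) (x - u) = bilin S x x - 2 * bilin S x u + bilin S u u.
Proof.
move=> SS; rewrite bilinDl !bilinDr !bilinNl !bilinNr (bilinC u x SS); ring.
Qed.

Lemma posdef_ge0 S x : sym_posdef S -> 0 <= bilin S x x.
Proof.
move=> [_ S0]; have [->|x0] := eqVneq x 0; last exact/ltW/S0.
by rewrite /bilin mulmx0 mxE.
Qed.

(** A nonzero vector in the left kernel of a singular [S] would make the quadratic form vanish. *)
Lemma posdef_unitmx S : sym_posdef S -> S \in unitmx.
Proof.
move=> [SS S0]; rewrite unitmxE unitfE; apply/negP => /det0P[v v0 vS].
have := S0 v^T; rewrite trmxK vS mul0mx mxE ltxx.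
move=> /(_ _)/negP; case => //.
by apply: contra v0 => /eqP v0; rewrite -[v]trmxK v0 trmx0.
Qed.

Lemma posdefD S Q : sym_posdef S -> sym_posdef Q -> sym_posdef (S + Q).
Proof.
move=> [SS S0] [QQ Q0]; split; first by rewrite linearD /= SS QQ.
by move=> x x0; rewrite -/(bilin _ x x) bilinDm addr_gt0 //;
  [exact: S0|exact: Q0].
Qed.

Lemma posdefZ a S : 0 < a -> sym_posdef S -> sym_posdef (a *: S).
Proof.
move=> a0 [SS S0]; split; first by rewrite linearZ /= SS.
by move=> x x0; rewrite -/(bilin _ x x) bilinZm mulr_gt0 //; exact: S0.
Qed.

(** The form of [invmx S] at [x] is the form of [S] at [invmx S *m x]. *)
Lemma posdefV S : sym_posdef S -> sym_posdef (invmx S).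
Proof.
move=> SP; have [SS S0] := SP; have SU := posdef_unitmx SP.
have VS : (invmx S)^T = invmx S by rewrite trmx_inv SS.
split=> // x x0; have := S0 (invmx S *m x).
rewrite trmx_mul VS !mulmxA mulmxKV //; apply.
by apply: contra x0 => /eqP e; rewrite -[x](mulKVmx SU) e mulmx0.
Qed.

Lemma posdef1 : sym_posdef (1%:M : 'M[R]_d).
Proof.
split=> [|x x0]; first exact: trmx1.
rewrite mulmx1 mxE lt_def; apply/andP; split; last first.
  by apply: sumr_ge0 => i _; rewrite mxE -expr2 sqr_ge0.
apply: contra x0; rewrite psumr_eq0 => [/allP x0|i _]; last first.
  by rewrite mxE -expr2 sqr_ge0.
apply/eqP/colP => i; have := x0 i (mem_index_enum _).
by rewrite !mxE -expr2 sqrf_eq0 => /eqP.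
Qed.

(* The polynomial det (1 + X (S - 1)) is 1 at 0 and does not vanish on [0, 1],
   where its argument stays positive definite. *)
Lemma posdef_det_gt0 S : sym_posdef S -> 0 < \det S.
Proof.
move=> SP.
pose p := \det (map_mx polyC 1%:M + 'X *: map_mx polyC (S - 1%:M)).
have pE t : p.[t] = \det (1%:M + t *: (S - 1%:M)).
  rewrite /p -[LHS]/(horner_eval t _) -det_map_mx; congr determinant.
  apply/matrixP => i j; rewrite !mxE.
  by rewrite /= /horner_eval hornerD hornerM !hornerC hornerX.
have p0 : p.[0] = 1 by rewrite pE scale0r addr0 det1.
have p1 : p.[1] = \det S by rewrite pE scale1r addrC subrK.
rewrite ltNge; apply/negP => S0.
have : (- p).[0] <= 0 <= (- p).[1].
  by rewrite !hornerN p0 p1 oppr_le0 ler01 oppr_ge0.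
move=> /(poly_ivt ler01)[t /andP[t0 t1]].
rewrite rootN rootE pE; apply/negP.
suff /posdef_unitmx : sym_posdef (1%:M + t *: (S - 1%:M)).
  by rewrite unitmxE unitfE.
have [->|tn0] := eqVneq t 0; first by rewrite scale0r addr0; exact: posdef1.
have [->|tn1] := eqVneq t 1; first by rewrite scale1r addrC subrK.
(* For [t] strictly between 0 and 1 both weights of this convex combination are positive. *)
rewrite (_ : _ + _ = (1 - t) *: 1%:M + t *: S); last first.
  by rewrite scalerBr scalerBl scale1r addrCA addrC.
apply: posdefD; apply: posdefZ => //; last by rewrite lt_neqAle eq_sym tn0.
- by rewrite subr_gt0 lt_neqAle tn1.
- exact: posdef1.
Qed.

Lemma posdef_cauchy_schwarz S x y : sym_posdef S ->
  bilin S x y ^+ 2 <= bilin S x x * bilin S y y.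
Proof.
move=> SP; have [SS S0] := SP.
have [->|y0] := eqVneq y 0.
  by rewrite /bilin !mulmx0 mxE mulr0 expr0n.
have yy : 0 < bilin S y y := S0 y y0.
(* This is the component of [x] orthogonal to [y], scaled to avoid a division; its form is
   [bilin S y y] times the difference of the two sides. *)
have := posdef_ge0 (bilin S y y *: x - bilin S x y *: y) SP.
rewrite bilin_sqrB // !bilinZl !bilinZr => h.
rewrite -subr_ge0 -(pmulr_rge0 _ yy); apply: le_trans h _.
by rewrite le_eqVlt; apply/orP; left; apply/eqP; ring.
Qed.

(* Cauchy-Schwarz against the i-th column of the inverse, since
   x_i = x^T A (A^-1 e_i). *)
Lemma posdef_coercive A : sym_posdef A ->
  exists2 c, 0 < c & forall x, c * (\sum_i x i 0 ^+ 2) <= bilin A x x.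
Proof.
move=> AP; have AU := posdef_unitmx AP.
pose v i : 'cV[R]_d := invmx A *m delta_mx i 0.
pose K := \sum_i bilin A (v i) (v i).
have K0 : 0 <= K by apply: sumr_ge0 => i _; exact: posdef_ge0.
exists (1 + K)^-1 => [|x]; first by rewrite invr_gt0 ltr_wpDr.
rewrite ler_pdivrMl ?ltr_wpDr // mulrDl mul1r ler_wpDl ?posdef_ge0 //.
rewrite mulr_suml; apply: ler_sum => i _.
have xi : bilin A x (v i) = x i 0.
  by rewrite /bilin /v mulmxA mulmxK // -colE !mxE.
by rewrite -xi mulrC; exact: posdef_cauchy_schwarz.
Qed.

End quadratic_forms.

(** * Lebesgue measure on tuples: reflections, iterated integrals, positivity *)

Section lebesgue_tuple_theory.
Variable R : realType.
Local Notation mR := (measurableTypeR R).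
Local Notation mu := (@lebesgue_measure R).
Local Open Scope ereal_scope.

Let measurable_subl (a : R) :
  measurable_fun [set: mR] (fun x : mR => (a - x)%R : mR).
Proof. by apply: measurable_funB. Qed.

(** By uniqueness of Lebesgue measure it suffices to compare half-open intervals; a reflection moves
    the closed end to the other side and keeps the length. *)
Lemma lebesgue_measure_reflect (a : R) (A : set mR) : measurable A ->
  mu A = pushforward mu (fun x : mR => (a - x)%R : mR) A.
Proof.
apply: lebesgue_measure_unique.
move=> X /ocitvP[->|[[u v] /= uv ->]]; first by rewrite !measure0.
rewrite /pushforward (_ : _ @^-1` _ = `[(a - v)%R, (a - u)%R[%classic).
  rewrite !lebesgue_measure_itv /= !lte_fin uv ltrD2l ltrN2 uv -!EFinB.
  by congr EFin; ring.
apply/seteqP; split => x /=; rewrite !in_itv /= => /andP[h1 h2];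
  apply/andP; split; lra.
Qed.


Lemma ge0_integral_reflect (a : R) (F : mR -> \bar R) :
  measurable_fun setT F -> (forall x, 0 <= F x) ->
  \int[mu]_x F (a - x)%R = \int[mu]_x F x.
Proof.
move=> mF F0.
have -> : \int[mu]_x F x =
    \int[pushforward mu (fun x : mR => (a - x)%R : mR)]_x F x.
  by apply: eq_measure_integral => A mA _; exact: lebesgue_measure_reflect.
by rewrite ge0_integral_pushforward.
Qed.

(** Tonelli, transported along [cons_pair]; it drives the inductions on the dimension below. *)
Lemma ge0_integral_lebesgue_tupleS d (F : d.+1.-tuple mR -> \bar R) :
  measurable_fun setT F -> (forall t, 0 <= F t) ->
  \int[lebesgue_tuple R d.+1]_t F t =
  \int[mu]_x \int[lebesgue_tuple R d]_t F [tuple of x :: t].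
Proof.
move=> mF F0; rewrite [LHS]ge0_integral_pushforward //; last first.
  exact: measurable_cons_pair.
rewrite preimage_setT fubini_tonelli1 // => [|p]; last exact: F0.
by apply: measurableT_comp => //; exact: measurable_cons_pair.
Qed.

Lemma measurable_consr d (x : mR) :
  measurable_fun setT (fun t : d.-tuple mR => [tuple of x :: t]).
Proof.
by apply: (@measurable_cons _ _ _ _ (fun=> x) d id); [exact: measurable_cst|].
Qed.

(** Point reflection with centre [a / 2]. *)
Definition reflect_tuple d (a : 'I_d -> R) (t : d.-tuple mR) : d.-tuple mR :=
  [tuple (a i - tnth t i)%R : mR | i < d].

Lemma measurable_reflect_tuple d (a : 'I_d -> R) :
  measurable_fun setT (reflect_tuple a).
Proof.
apply/measurable_fun_tnthP => i.
rewrite (_ : _ \o _ = (fun x : mR => (a i - x)%R : mR) \o @tnth _ mR ^~ i).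
  by apply: (measurableT_comp (measurable_subl _)); exact: measurable_tnth.
by apply/funext => t /=; rewrite tnth_mktuple.
Qed.

Lemma reflect_tuple_cons d (a : 'I_d.+1 -> R) x (t : d.-tuple mR) :
  reflect_tuple a [tuple of x :: t] =
  [tuple of (a ord0 - x)%R :: reflect_tuple (a \o lift ord0) t].
Proof.
apply: eq_from_tnth => i; rewrite tnth_mktuple.
have [j ->|->//] := unliftP ord0 i.
by rewrite !tnthS tnth_mktuple.
Qed.

Lemma ge0_integral_reflect_tuple d (a : 'I_d -> R) (F : d.-tuple mR -> \bar R) :
  measurable_fun setT F -> (forall t, 0 <= F t) ->
  \int[lebesgue_tuple R d]_t F (reflect_tuple a t) =
  \int[lebesgue_tuple R d]_t F t.
Proof.
elim: d a F => [|d IH] a F mF F0.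
  by apply: eq_integral => t _; rewrite [reflect_tuple a t]tuple0 [t]tuple0.
rewrite !ge0_integral_lebesgue_tupleS //; last first.
  by apply: measurableT_comp => //; exact: measurable_reflect_tuple.
rewrite -[RHS](ge0_integral_reflect (a ord0)); last 2 first.
- apply: (measurable_fun_fubini_tonelli_F (F \o @cons_pair R d)) => [|p].
    by apply: measurableT_comp => //; exact: measurable_cons_pair.
  exact: F0.
- by move=> x; exact: integral_ge0.
apply: eq_integral => x _.
under eq_integral do rewrite reflect_tuple_cons.
rewrite (IH _ (fun t => F [tuple of (a ord0 - x)%R :: t])) //.
by apply: measurableT_comp => //; exact: measurable_consr.
Qed.

(** The reflection exchanges the positive and negative parts, so their integrals agree;
    integrability makes them finite, and the difference is 0 rather than an indeterminate form. *)
Lemma integral_reflect_tuple_odd d (a : 'I_d -> R) (F : d.-tuple mR -> \bar R) :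
  measurable_fun setT F -> (forall t, F (reflect_tuple a t) = - F t) ->
  \int[lebesgue_tuple R d]_t `|F t| < +oo ->
  \int[lebesgue_tuple R d]_t F t = 0.
Proof.
move=> mF oddF Foo.
have iF : (lebesgue_tuple R d).-integrable setT F by apply/integrableP.
rewrite integralE.
have -> : \int[lebesgue_tuple R d]_t F^\- t = \int[lebesgue_tuple R d]_t F^\+ t.
  rewrite -(ge0_integral_reflect_tuple a).
  - by apply: eq_integral => t _; rewrite funenegE funeposE oddF oppeK.
  - exact: measurable_funeneg.
  - by move=> t; exact: funeneg_ge0.
by rewrite subee // integrable_pos_fin_num.
Qed.

(** By induction on [d], the integral factors into one-dimensional integrals. *)
Lemma ge0_integral_prod_tuple_lty d (h : 'I_d -> R -> R) :
  (forall i, measurable_fun setT (h i)) -> (forall i x, (0 <= h i x)%R) ->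
  (forall i, \int[mu]_x (h i x)%:E < +oo) ->
  \int[lebesgue_tuple R d]_t (\prod_i h i (tnth t i))%:E < +oo.
Proof.
elim: d h => [|d IH] h mh h0 hoo.
  under eq_integral do rewrite big_ord0.
  by rewrite integral_cst //= diracT mule1 ltry.
rewrite ge0_integral_lebesgue_tupleS; last 2 first.
- apply/measurable_EFinP; apply: measurable_prod => i _.
  by apply: (measurableT_comp (mh _)); exact: measurable_tnth.
- by move=> t; rewrite lee_fin prodr_ge0.
have -> : (fun x => \int[lebesgue_tuple R d]_t
      (\prod_i h i (tnth [tuple of x :: t] i))%:E) =
    (fun x => (h ord0 x)%:E * \int[lebesgue_tuple R d]_t
      (\prod_i h (lift ord0 i) (tnth t i))%:E).
  apply/funext => x; rewrite -ge0_integralZl ?lee_fin //.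
  - apply: eq_integral => t _; rewrite big_ord_recl EFinM.
    congr (_ * _%:E); apply: eq_bigr => i _.
    exact: (congr1 (h _) (tnthS _ _ _)).
  - apply/measurable_EFinP; apply: measurable_prod => i _.
    by apply: (measurableT_comp (mh _)); exact: measurable_tnth.
  - by move=> t _; rewrite lee_fin prodr_ge0.
have C0 : 0 <= \int[lebesgue_tuple R d]_t
    (\prod_i h (lift ord0 i) (tnth t i))%:E.
  by apply: integral_ge0 => t _; rewrite lee_fin prodr_ge0.
rewrite ge0_integralZr //.
- have H0 : 0 <= \int[mu]_x (h ord0 x)%:E.
    by apply: integral_ge0 => x _; rewrite lee_fin.
  apply: lte_mul_pinfty; rewrite ?ge0_fin_numE //.
  by apply: (IH (fun i => h (lift ord0 i))) => i;
    [exact: mh|exact: h0|exact: hoo].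
- by apply/measurable_EFinP; exact: mh.
- by move=> x _; rewrite lee_fin.
Qed.

Lemma lebesgue_tupleT_neq0 d : lebesgue_tuple R d setT != 0.
Proof.
elim: d => [|d IH]; first by rewrite /= diracT onee_eq0.
rewrite -[_ setT]mul1e -(integral_cst _ measurableT).
rewrite ge0_integral_lebesgue_tupleS //.
rewrite (_ : (fun _ => _) = cst (lebesgue_tuple R d setT)); last first.
  by apply/funext => x; rewrite (integral_cst _ measurableT) mul1e.
rewrite (integral_cst _ measurableT) mule_eq0 negb_or IH /=.
by rewrite -set_itvNyy lebesgue_measure_itv.
Qed.

(** A zero integral would make [F] vanish almost everywhere, so the whole space would be
    negligible. *)
Lemma integral_lebesgue_tuple_gt0 d (F : d.-tuple mR -> \bar R) :
  measurable_fun setT F -> (forall t, 0 < F t) ->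
  0 < \int[lebesgue_tuple R d]_t F t.
Proof.
move=> mF F0; rewrite lt_def integral_ge0 ?andbT => [|t _]; last exact/ltW.
apply/eqP => I0; have : \int[lebesgue_tuple R d]_t `|F t| = 0.
  by rewrite -[RHS]I0; apply: eq_integral => t _; rewrite gee0_abs // ltW.
move/(ae_eq_integral_abs _ measurableT mF) => -[N [mN N0 FN]].
have NT : N = setT.
  by apply/seteqP; split => // t _; apply: FN => /= /(_ I) Ft0; have := F0 t;
    rewrite Ft0 ltxx.
by have := lebesgue_tupleT_neq0 d; rewrite -NT N0 eqxx.
Qed.

End lebesgue_tuple_theory.

(** * Integrability, symmetry and mean of Gaussian kernels *)

Section gaussian_integrals.
Variable R : realType.
Local Notation mR := (measurableTypeR R).
Local Notation mu := (@lebesgue_measure R).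

Lemma integral_gauss_lty (a m : R) : 0 < a ->
  (\int[mu]_x (expR (- (a * (x - m) ^+ 2)))%:E < +oo)%E.
Proof.
(* With variance [1 / (2 a)] the integrand is a multiple of a normal density, whose integral is
   1. *)
move=> a0; pose s := Num.sqrt (a *+ 2)^-1.
have s0 : s != 0 by rewrite gt_eqF // sqrtr_gt0 invr_gt0 pmulrn_lgt0.
have sE : s ^+ 2 *+ 2 = a^-1.
  rewrite sqr_sqrtr ?invr_ge0 ?pmulrn_lge0 // 1?ltW //.
  by rewrite -mulr_natr -(mulr_natr a) invfM divfK ?pnatr_eq0.
have pk := normal_peak_gt0 s0.
have E x : expR (- (a * (x - m) ^+ 2)) = (normal_peak s)^-1 * normal_pdf m s x.
  rewrite normal_pdfE // mulKf ?gt_eqF // /normal_fun sE invrK.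
  by congr expR; ring.
under eq_integral do rewrite E EFinM.
rewrite ge0_integralZl_EFin //.
- by rewrite integral_normal_pdf mule1 ltry.
- by move=> x _; rewrite lee_fin normal_pdf_ge0.
- by apply/measurable_EFinP; exact: measurable_normal_pdf.
- by rewrite invr_ge0 ltW.
Qed.

Variable d : nat.
Implicit Types (A : 'M[R]_d) (m : 'cV[R]_d) (t : d.-tuple mR).

Local Notation vol := (lebesgue_tuple R d).

Lemma measurable_colt i :
  measurable_fun setT (fun t : d.-tuple mR => colt t i 0).
Proof.
rewrite (_ : (fun _ => _) = (fun t => tnth t i)); first exact: measurable_tnth.
by apply/funext => t; rewrite mxE.
Qed.

Lemma measurable_coltB m i :
  measurable_fun setT (fun t : d.-tuple mR => (colt t - m) i 0).
Proof.
rewrite (_ : (fun _ => _) = (fun t => colt t i 0 - m i 0)).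
  by apply: measurable_funB => //; exact: measurable_colt.
by apply/funext => t; rewrite !mxE.
Qed.

(** Unnormalized Gaussian density with mean [m] and precision matrix [A]. *)
Definition gauss_kernel A m x : R := expR (- (bilin A (x - m) (x - m) / 2)).

Lemma measurable_gauss_kernel A m :
  measurable_fun setT (fun t : d.-tuple mR => gauss_kernel A m (colt t)).
Proof.
apply: measurableT_comp => //; apply: measurable_funN.
apply: measurable_funM => //.
rewrite (_ : (fun _ => _) = (fun t => \sum_j (\sum_i (colt t - m) i 0 * A i j)
    * (colt t - m) j 0)); last first.
  apply/funext => t; rewrite /bilin mxE; apply: eq_bigr => j _.
  by rewrite mxE; congr (_ * _); apply: eq_bigr => i _; rewrite mxE.
apply: measurable_sum => j; apply: measurable_funM;
  last exact: measurable_coltB.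
apply: measurable_sum => i; apply: measurable_funM => //.
exact: measurable_coltB.
Qed.

(** The bound has two equal factors: the product form is integrable coordinate by coordinate, the
    other one is kept in reserve to absorb the linear factor of a first moment. *)
Lemma gauss_kernel_le A m : sym_posdef A -> exists2 a, 0 < a & forall x,
  gauss_kernel A m x <=
  expR (- (a * \sum_i (x - m) i 0 ^+ 2)) *
  \prod_i expR (- (a * (x - m) i 0 ^+ 2)).
Proof.
(* One factor 1/2 comes from the exponent of the kernel, the other from sharing the decay between
   two factors. *)
move=> /posdef_coercive[c c0 cA]; exists (c / 4) => [|x].
  by rewrite divr_gt0.
rewrite -expR_sum -expRD ler_expR sumrN -mulr_sumr -opprD lerN2.
by have := cA (x - m); lra.
Qed.

Lemma integrable_gauss_dom (a : R) m : 0 < a ->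
  vol.-integrable setT
    (fun t => (\prod_i expR (- (a * (colt t - m) i 0 ^+ 2)))%:E).
Proof.
move=> a0; apply/integrableP; split.
  apply/measurable_EFinP; apply: measurable_prod => i _.
  apply: measurableT_comp => //; apply: measurable_funN.
  apply: measurable_funM => //; apply: measurable_funX.
  exact: measurable_coltB.
rewrite [ltLHS](_ : _ = \int[vol]_t
    (\prod_i expR (- (a * (tnth t i - m i 0) ^+ 2)))%:E)%E.
  apply: (ge0_integral_prod_tuple_lty
    (h := fun i x => expR (- (a * (x - m i 0) ^+ 2)))).
  - move=> i; apply: measurableT_comp => //; apply: measurable_funN.
    apply: measurable_funM => //; apply: measurable_funX.
    exact: measurable_funB.
  - by move=> i x; exact: expR_ge0.
  - by move=> i; exact: integral_gauss_lty.
apply: eq_integral => t _; rewrite gee0_abs ?lee_fin ?prodr_ge0 //.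
by congr EFin; apply: eq_bigr => i _; rewrite !mxE.
Qed.

Lemma integrable_gauss_kernel A m : sym_posdef A ->
  vol.-integrable setT (fun t => (gauss_kernel A m (colt t))%:E).
Proof.
move=> /(gauss_kernel_le m)[a a0 ub].
apply: (le_integrable _ _ _ (integrable_gauss_dom m a0)) => //.
  by apply/measurable_EFinP; exact: measurable_gauss_kernel.
have D0 x : 0 <= \prod_i expR (- (a * (x - m) i 0 ^+ 2)).
  by apply: prodr_ge0 => j _; exact: expR_ge0.
move=> t _; rewrite lee_fin !ger0_norm ?expR_ge0 //.
apply: le_trans (ub _) _; rewrite ler_piMl //.
rewrite -[leRHS]expR0 ler_expR oppr_le0 mulr_ge0 ?(ltW a0) //.
by apply: sumr_ge0 => i _; exact: sqr_ge0.
Qed.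

(* |u| <= 1 + u^2 <= (1 + 1/a) (1 + a u^2) <= (1 + 1/a) exp (a u^2) *)
Lemma norm_le_expR_sqr (a u : R) : 0 < a ->
  `|u| <= (1 + a^-1) * expR (a * u ^+ 2).
Proof.
move=> a0; apply: (@le_trans _ _ ((1 + a^-1) * (1 + a * u ^+ 2))); last first.
  by rewrite ler_wpM2l ?addr_ge0 ?invr_ge0 ?(ltW a0) // expR_ge1Dx.
rewrite mulrDl mul1r mulrDr mulKf ?gt_eqF // mulr1.
have a1 : 0 < a^-1 by rewrite invr_gt0.
have u2 : 0 <= a * u ^+ 2 by rewrite mulr_ge0 ?sqr_ge0 ?ltW.
apply: (@le_trans _ _ (1 + u ^+ 2)); last by lra.
by case: (ger0P u) => _; nra.
Qed.

Lemma integrable_gauss_kernel_centered A m i : sym_posdef A ->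
  vol.-integrable setT
    (fun t => ((colt t - m) i 0 * gauss_kernel A m (colt t))%:E).
Proof.
move=> /(gauss_kernel_le m)[a a0 ub].
have K0 : 0 <= 1 + a^-1 by rewrite addr_ge0 // invr_ge0 ltW.
have D0 x : 0 <= \prod_i expR (- (a * (x - m) i 0 ^+ 2)).
  by apply: prodr_ge0 => j _; exact: expR_ge0.
apply: (le_integrable _ _ _
  (integrableZl _ (1 + a^-1) (integrable_gauss_dom m a0))) => //.
  apply/measurable_EFinP; apply: measurable_funM; first exact: measurable_coltB.
  exact: measurable_gauss_kernel.
move=> t _; rewrite -EFinM lee_fin [leRHS]ger0_norm ?mulr_ge0 // normrM.
rewrite [X in _ * X]ger0_norm ?expR_ge0 //.
apply: le_trans (ler_wpM2l (normr_ge0 _) (ub _)) _.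
rewrite mulrA ler_wpM2r //.
apply: le_trans (ler_wpM2r (expR_ge0 _) (norm_le_expR_sqr _ a0)) _.
(* The growth in coordinate [i] is cancelled by the reserved factor, since the full sum of squares
   dominates its [i]-th term. *)
rewrite -mulrA ler_piMr // -expRD -[leRHS]expR0 ler_expR subr_le0.
rewrite ler_wpM2l ?(ltW a0) // (bigD1 i) //= lerDl sumr_ge0 // => j _.
exact: sqr_ge0.
Qed.

Lemma colt_reflect m t :
  colt (reflect_tuple (fun i => 2 * m i 0) t) - m = - (colt t - m).
Proof. by apply/colP => i; rewrite !mxE tnth_mktuple; ring. Qed.

Lemma integral_gauss_kernel_centered A m i : sym_posdef A ->
  (\int[vol]_t ((colt t - m) i 0 * gauss_kernel A m (colt t))%:E = 0)%E.
Proof.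
move=> /(integrable_gauss_kernel_centered m i)/integrableP[mF Foo].
apply: (integral_reflect_tuple_odd (a := fun i => 2 * m i 0)) => // t.
by rewrite /gauss_kernel colt_reflect bilinNl bilinNr opprK mxE mulNr EFinN.
Qed.

(** Finiteness is needed as well as positivity, because [fine] sends an infinite integral to 0. *)
Lemma Rintegral_gauss_kernel_gt0 A m : sym_posdef A ->
  0 < \int[vol]_t gauss_kernel A m (colt t).
Proof.
move=> AP; rewrite /Rintegral fine_gt0 //; apply/andP; split.
  apply: integral_lebesgue_tuple_gt0 => [|t]; last by rewrite lte_fin expR_gt0.
  by apply/measurable_EFinP; exact: measurable_gauss_kernel.
by apply: integrable_lty => //; exact: integrable_gauss_kernel.
Qed.

Lemma pdf_mean_gauss A m (f : 'cV[R]_d -> R) (K : R) : sym_posdef A -> K != 0 ->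
  (forall x, f x = K * gauss_kernel A m x) ->
  pdf_mean (fun x => f x / \int[vol]_t f (colt t)) = m.
Proof.
move=> AP K0 fE; apply/colP => i; rewrite mxE.
have Ig := integrable_gauss_kernel m AP.
have Z0 := Rintegral_gauss_kernel_gt0 m AP.
set Z := Rintegral _ _ _ in Z0.
have -> : \int[vol]_t f (colt t) = K * Z.
  by under eq_Rintegral do rewrite fE; rewrite RintegralZl.
(* Splitting the coordinate as its deviation from [m] plus [m i 0] leaves an odd integral, which is
   0, and [m i 0] times the total mass 1. *)
have E t : colt t i 0 * (f (colt t) / (K * Z)) =
    Z^-1 * ((colt t - m) i 0 * gauss_kernel A m (colt t)) +
    (m i 0 / Z) * gauss_kernel A m (colt t).
  by rewrite fE !mxE; field; rewrite K0 gt_eqF.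
under eq_Rintegral do rewrite E.
have Ic := integrable_gauss_kernel_centered m i AP.
rewrite RintegralD //.
- rewrite !RintegralZl // -/Z divfK ?gt_eqF //.
  by rewrite {1}/Rintegral integral_gauss_kernel_centered //= mulr0 add0r.
- exact: (integrableZl _ _ Ic).
- exact: (integrableZl _ _ Ig).
Qed.

End gaussian_integrals.

(** * The posterior mean in closed form *)

Section conjugate_gaussian.
Variables (R : realType) (d : nat).
Implicit Types (mu x theta : 'cV[R]_d) (S Lambda : 'M[R]_d).

Definition gauss_const S : R := (Num.sqrt ((2 * pi) ^+ d * \det S))^-1.

(** A nonpositive determinant would give the value 0, by the conventions for square root and
    inverse. *)
Lemma gauss_const_gt0 S : sym_posdef S -> 0 < gauss_const S.
Proof.
move=> /posdef_det_gt0 S0; rewrite invr_gt0 sqrtr_gt0 mulr_gt0 // exprn_gt0 //.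
by rewrite mulr_gt0 // pi_gt0.
Qed.

Lemma likelihoodE n Lambda (y : 'I_n -> 'cV[R]_d) theta :
  likelihood Lambda y theta = gauss_const Lambda ^+ n *
    expR (- (\sum_i bilin (invmx Lambda) (y i - theta) (y i - theta) / 2)).
Proof.
rewrite /likelihood /gauss_pdf big_split /= prodr_const card_ord -expR_sum.
by rewrite sumrN.
Qed.

Lemma posterior_meanE n (mupi : 'cV[R]_d) Sigmapi Lambda
    (y : 'I_n -> 'cV[R]_d) :
  (0 < n)%N -> sym_posdef Sigmapi -> sym_posdef Lambda ->
  posterior_mean mupi Sigmapi Lambda y =
  invmx (invmx Sigmapi + n%:R *: invmx Lambda) *m
    (invmx Sigmapi *m mupi + n%:R *: invmx Lambda *m sample_mean y).
Proof.
move=> n0 SP LP; set Q := invmx Lambda; set S := invmx Sigmapi.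
have nR : n%:R != 0 :> R by rewrite pnatr_eq0 -lt0n.
have SP' : sym_posdef S := posdefV SP.
have QP : sym_posdef Q := posdefV LP.
have AP : sym_posdef (S + n%:R *: Q).
  by apply: posdefD => //; apply: posdefZ => //; rewrite ltr0n.
set A := S + n%:R *: Q in AP *; set m := invmx A *m _.
have Am : A *m m = S *m mupi + Q *m \sum_i y i.
  rewrite mulKVmx ?posdef_unitmx //; congr (_ + _).
  by rewrite /sample_mean -scalemxAr -scalemxAl scalerA mulVf ?scale1r.
have [SS _] := SP'; have [QQ _] := QP; have [AA _] := AP.
(* The part of the exponent independent of [x] that is left after completing the square. *)
pose c := (bilin A m m - bilin S mupi mupi -
  \sum_i bilin Q (y i) (y i)) / 2.
apply: (@pdf_mean_gauss _ _ A m
  (fun x => gauss_pdf mupi Sigmapi x * likelihood Lambda y x)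
  (gauss_const Sigmapi * gauss_const Lambda ^+ n * expR c)) => // [|x].
  by rewrite !mulf_neq0 ?expf_neq0 // gt_eqF ?expR_gt0 // gauss_const_gt0.
rewrite likelihoodE /gauss_pdf -/(gauss_const _) -/(bilin _ _ _) mulrACA.
rewrite -!mulrA; do 2![congr (_ * _)]; rewrite -!expRD; congr expR.
rewrite -mulr_suml; under eq_bigr do rewrite (bilin_sqrB _ _ QQ).
rewrite !big_split /= sumrN -mulr_sumr.
have -> : \sum_i bilin Q (y i) x = bilin Q x (\sum_i y i).
  by rewrite bilin_sumr; apply: eq_bigr => i _; rewrite bilinC.
rewrite sumr_const card_ord -[bilin Q x x *+ n]mulr_natl -bilinZm.
rewrite !bilin_sqrB // /c.
have -> : bilin A x m = bilin S x mupi + bilin Q x (\sum_i y i).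
  by rewrite -[bilin A x m]/(_ 0 0) -mulmxA Am mulmxDr mxE /bilin !mulmxA.
by rewrite [bilin A x x]bilinDm !bilinZm -/S; field.
Qed.

End conjugate_gaussian.

(* P, on an arbitrary sample space, together with the random vectors y_i is the
   true data generating model; it is unrelated to the Gaussian model from which
   the posterior is computed. *)
Theorem theorem3p3 (R : realType) (d n : nat)
    (disp : measure_display) (T : measurableType disp) (P : probability T R)
    (y : 'I_n -> {RV P >-> d.-tuple (measurableTypeR R)})
    (mupi lambda : 'cV[R]_d) (Lambda Sigmapi : 'M[R]_d)
    (hd : (1 < d)%N) (hn : (1 <= n)%N)
    (hLambda : sym_posdef Lambda) (hSigmapi : sym_posdef Sigmapi) :
  let data (w : T) (i : 'I_n) : 'cV[R]_d := colt (y i w) in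
  let ybar (w : T) : 'cV[R]_d := sample_mean (data w) in
  let SigmaL : 'M[R]_d := n%:R^-1 *: Lambda in
  let Sigmap : 'M[R]_d := invmx (invmx Sigmapi + invmx SigmaL) in
  let mup (w : T) : 'cV[R]_d := posterior_mean mupi Sigmapi Lambda (data w) in
  P [set w | DPP (linear_eta lambda mupi) (linear_eta lambda (ybar w))
                 (linear_eta lambda (mup w))]
  = P [set w |
        n%:R * (lambda^T *m Sigmap *m invmx Lambda
                 *m (ybar w - mupi) *m (ybar w - mupi)^T
                 *m invmx Sigmapi *m Sigmap *m lambda) 0 0 < 0].

Proof.
move=> data ybar SigmaL Sigmap mup; congr (P _); apply/seteqP.
have nR : n%:R != 0 :> R by rewrite pnatr_eq0 -lt0n.
have SP := posdefV hSigmapi; have LP := posdefV hLambda.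
have QE : invmx SigmaL = n%:R *: invmx Lambda.
  rewrite /SigmaL invmxZ ?invrK //.
  by apply/posdef_unitmx/posdefZ => //; rewrite invr_gt0 ltr0n.
have AP : sym_posdef (invmx Sigmapi + invmx SigmaL).
  by rewrite QE; apply: posdefD => //; apply: posdefZ; rewrite ?ltr0n.
have [SpS _] := posdefV AP.
suff E w : (linear_eta lambda (mup w) - linear_eta lambda mupi) *
      (linear_eta lambda (mup w) - linear_eta lambda (ybar w)) =
    - (n%:R * (lambda^T *m Sigmap *m invmx Lambda
                 *m (ybar w - mupi) *m (ybar w - mupi)^T
                 *m invmx Sigmapi *m Sigmap *m lambda) 0 0).
  by split => w /=; rewrite /DPP E oppr_gt0.
set delta := ybar w - mupi.
have mupE : mup w = Sigmap *m (invmx Sigmapi *m mupi + invmx SigmaL *m ybar w).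
  by rewrite /mup posterior_meanE // -QE.
have etaB u v : linear_eta lambda u - linear_eta lambda v =
    (lambda^T *m (u - v)) 0 0.
  by rewrite /linear_eta mulmxBr !mxE.
(* Written this way, [mupi] and [ybar w] each share one of the two summands of [mup w], which
   cancels in the difference. *)
have SpK v : v = Sigmap *m (invmx Sigmapi *m v + invmx SigmaL *m v).
  by rewrite -mulmxDl mulKmx // posdef_unitmx.
have -> : linear_eta lambda (mup w) - linear_eta lambda mupi =
    n%:R * (lambda^T *m Sigmap *m invmx Lambda *m delta) 0 0.
  rewrite etaB mupE {2}(SpK _ mupi) -mulmxBr opprD addrACA subrr add0r -mulmxBr.
  by rewrite QE -scalemxAl -!scalemxAr mxE !mulmxA.
have -> : linear_eta lambda (mup w) - linear_eta lambda (ybar w) =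
    - (lambda^T *m Sigmap *m invmx Sigmapi *m delta) 0 0.
  rewrite etaB mupE {2}(SpK _ (ybar w)) -mulmxBr opprD addrACA subrr addr0.
  by rewrite -mulmxBr -opprB !mulmxN mxE !mulmxA.
(* By symmetry of [Sigmap] and [invmx Sigmapi], the right half of the product is the transpose of
   the 1 by 1 matrix from the second difference. *)
have -> : lambda^T *m Sigmap *m invmx Lambda *m delta *m delta^T
      *m invmx Sigmapi *m Sigmap *m lambda =
    (lambda^T *m Sigmap *m invmx Lambda *m delta) *m
    (lambda^T *m Sigmap *m invmx Sigmapi *m delta)^T.
  by rewrite !trmx_mul trmxK SpS (proj1 SP) !mulmxA.
by rewrite [in RHS]mxE big_ord1 mulrN mulrA; congr (- (_ * _));
  rewrite [RHS]mxE.
Qed.
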